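(* Over $\mathbf{ZF}$, the Axiom of Choice is equivalent to the statement: ''Every Veloso problem has a solution function.''
   Context: The base theory is $\mathbf{ZF}$ (no choice is assumed). The Axiom of Choice asserts that every family of non-empty sets has a choice function. A Kolmogorov problem is a triple $P=(I,S,\sigma)$ where $I$ and $S$ are sets (the set of instances and the set of possible solutions) and $\sigma\subseteq I\times S$ is a relation; $z\,\sigma\,s$ is read ''$s$ solves $z$''. $P$ is viable if for every $z\in I$ there is $s\in S$ with $z\,\sigma\,s$. $P$ is non-generic if for every $s\in S$ there is $z\in I$ with $\neg(z\,\sigma\,s)$. A Veloso problem is a Kolmogorov problem $(I,S,\sigma)$, with $I$ and $S$ non-empty sets (of arbitrary size), that is viable and non-generic. A solution function for a viable Kolmogorov problem $P=(I,S,\sigma)$ is a function $f:I\to S$ with $f\subseteq\sigma$, i.e. $z\,\sigma\,f(z)$ for every $z\in I$. *)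

(* Defs.v *)
From Stdlib Require Import Utf8.

Set Implicit Arguments.
Unset Strict Implicit.

(* A structure for the first-order language {∈} of set theory.  Set equality is
   interpreted by Leibniz equality of the carrier. *)
Record set_structure : Type := SetStructure {
  carrier :> Type;
  mem : carrier -> carrier -> Prop
}.

Declare Scope st_scope.
Delimit Scope st_scope with st.
Notation "x ∈ y" := (mem x y) (at level 70, no associativity) : st_scope.
Open Scope st_scope.

(* Formulas of the language {∈, =}, with de Bruijn indices for variables.  They
   are needed because the axiom schemas of ZF range over first-order formulas
   with parameters, not over all Rocq predicates: the latter would give
   second-order ZF. *)
Inductive formula : Type :=
| fMem (i j : nat)
| fEq (i j : nat)
| fNot (phi : formula)
| fAnd (phi psi : formula)
| fOr (phi psi : formula)
| fImp (phi psi : formula)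
| fAll (phi : formula)
| fEx (phi : formula).

Definition scons (A : Type) (x : A) (e : nat -> A) (n : nat) : A :=
  match n with
  | 0 => x
  | S k => e k
  end.

Fixpoint sat (M : set_structure) (e : nat -> M) (phi : formula) : Prop :=
  match phi with
  | fMem i j => e i ∈ e j
  | fEq i j => e i = e j
  | fNot p => ~ sat e p
  | fAnd p q => sat e p /\ sat e q
  | fOr p q => sat e p \/ sat e q
  | fImp p q => sat e p -> sat e q
  | fAll p => forall x : M, sat (scons x e) p
  | fEx p => exists x : M, sat (scons x e) p
  end.

Definition subset (M : set_structure) (x y : M) : Prop :=
  forall z : M, z ∈ x -> z ∈ y.

Definition nonempty (M : set_structure) (x : M) : Prop :=
  exists z : M, z ∈ x.

Definition is_upair (M : set_structure) (p x y : M) : Prop :=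
  forall z : M, z ∈ p <-> z = x \/ z = y.

Definition is_union (M : set_structure) (u x : M) : Prop :=
  forall z : M, z ∈ u <-> exists y : M, y ∈ x /\ z ∈ y.

(* s = n ∪ {n} *)
Definition is_succ (M : set_structure) (s n : M) : Prop :=
  forall z : M, z ∈ s <-> z ∈ n \/ z = n.

(* In the two schemas the environment [e] supplies the parameters of [phi]. *)
Record ZF (M : set_structure) : Prop := {
  ZF_extensionality :
    forall x y : M, (forall z : M, z ∈ x <-> z ∈ y) -> x = y;
  ZF_foundation :
    forall x : M, nonempty x ->
      exists y : M, y ∈ x /\ ~ (exists z : M, z ∈ y /\ z ∈ x);
  ZF_pairing :
    forall x y : M, exists p : M, is_upair p x y;
  ZF_union :
    forall x : M, exists u : M, is_union u x;
  ZF_powerset :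
    forall x : M, exists p : M, forall z : M, z ∈ p <-> subset z x;
  ZF_infinity :
    exists w : M,
      (exists o : M, o ∈ w /\ ~ nonempty o) /\
      (forall n : M, n ∈ w -> exists s : M, s ∈ w /\ is_succ s n);
  ZF_separation :
    forall (phi : formula) (e : nat -> M) (x : M),
      exists y : M, forall z : M, z ∈ y <-> z ∈ x /\ sat (scons z e) phi;
  ZF_replacement :
    forall (phi : formula) (e : nat -> M) (x : M),
      (forall u v v' : M, u ∈ x ->
         sat (scons v (scons u e)) phi -> sat (scons v' (scons u e)) phi ->
         v = v') ->
      exists y : M, forall v : M,
        v ∈ y <-> exists u : M, u ∈ x /\ sat (scons v (scons u e)) phi
}.

(* Kuratowski pairs: p = {{a}, {a, b}} *)
Definition is_pair (M : set_structure) (p a b : M) : Prop :=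
  forall x : M, x ∈ p <-> is_upair x a a \/ is_upair x a b.

(* (a, b) ∈ r *)
Definition related (M : set_structure) (r a b : M) : Prop :=
  exists p : M, is_pair p a b /\ p ∈ r.

(* r ⊆ A × B *)
Definition is_relation (M : set_structure) (r A B : M) : Prop :=
  forall p : M, p ∈ r -> exists a b : M, a ∈ A /\ b ∈ B /\ is_pair p a b.

(* Functions, like relations, are elements of the structure (sets of pairs),
   not Rocq functions. *)
Definition is_function (M : set_structure) (f A B : M) : Prop :=
  is_relation f A B /\
  forall a : M, a ∈ A -> exists! b : M, related f a b.

Definition choice_function (M : set_structure) (F f : M) : Prop :=
  (exists U : M, is_union U F /\ is_function f F U) /\
  forall X x : M, related f X x -> x ∈ X.

Definition axiom_of_choice (M : set_structure) : Prop :=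
  forall F : M, (forall X : M, X ∈ F -> nonempty X) ->
    exists f : M, choice_function F f.

Record kolmogorov_problem (M : set_structure) : Type := KolmogorovProblem {
  instances : M;
  solutions : M;
  solves : M;
  solves_relation : is_relation solves instances solutions
}.

Definition viable (M : set_structure) (P : kolmogorov_problem M) : Prop :=
  forall z : M, z ∈ instances P ->
    exists s : M, s ∈ solutions P /\ related (solves P) z s.

Definition non_generic (M : set_structure) (P : kolmogorov_problem M) : Prop :=
  forall s : M, s ∈ solutions P ->
    exists z : M, z ∈ instances P /\ ~ related (solves P) z s.

Definition veloso_problem (M : set_structure) (P : kolmogorov_problem M) :
    Prop :=
  nonempty (instances P) /\ nonempty (solutions P) /\
  viable P /\ non_generic P.

Definition solution_function (M : set_structure) (P : kolmogorov_problem M)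
    (f : M) : Prop :=
  is_function f (instances P) (solutions P) /\ subset f (solves P).

(* Main.v *)
Require Import Defs.
From Stdlib Require Import Classical_Prop.

Set Implicit Arguments.
Unset Strict Implicit.

(** Choice gives solutions.  Let [P] be viable, and for an instance [z] let its
    fiber be the set of all [s] that solve [z].  Viability makes every fiber a
    non-empty subset of the solution set [S], so a choice function [c] on the
    family of all non-empty subsets of [S] yields the solution function sending
    [z] to the value of [c] at the fiber of [z].

    Solutions give choice.  Let [F] be a family of non-empty sets with union
    [U].  The problem of finding an element of a given member of [F] is viable,
    and its solution functions are the choice functions of [F]; but it is
    generic when some element lies in all members of [F].  This is repaired by
    adjoining a new instance, solved by a new solution and by nothing else.  By
    foundation [F] is not in [F] and [U] is not in [U], so [F] and [U] can serve
    as the new instance and the new solution.  An element of [U] then fails at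
    [F], and [U] fails at any member of [F]: this is where [F] has to be
    non-empty, and for empty [F] the empty set is a choice function.  A solution
    function of the enlarged problem restricts to a choice function of [F].

    All sets used must come from the axioms of the structure, so each of them is
    carved out by an explicit first-order formula.  The lemma
    [relation_comprehension] does this for relations, and
    [is_pair_injective] makes membership in them readable on coordinates. *)

(** * Formulas for the set-theoretic vocabulary *)

(** These formulas mirror the corresponding predicates connective by connective,
    so that their satisfaction is convertible to the predicate. *)
Definition fIff (phi psi : formula) : formula :=
  fAnd (fImp phi psi) (fImp psi phi).

Definition fUpair (p x y : nat) : formula :=
  fAll (fIff (fMem 0 (S p)) (fOr (fEq 0 (S x)) (fEq 0 (S y)))).

Definition fPair (p a b : nat) : formula :=
  fAll (fIff (fMem 0 (S p)) (fOr (fUpair 0 (S a) (S a)) (fUpair 0 (S a) (S b)))).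

Definition fRelated (r a b : nat) : formula :=
  fEx (fAnd (fPair 0 (S a) (S b)) (fMem 0 (S r))).

(** * Elementary consequences of the axioms *)

(** A member of [{x}] disjoint from [{x}] can only be [x]. *)
Lemma mem_irreflexive (M : set_structure) (HM : ZF M) (x : M) : ~ x ∈ x.
Proof.
  intros Hx.
  destruct (ZF_pairing HM x x) as [p Hp].
  destruct (ZF_foundation HM (x := p)) as [y [Hy Hdisj]].
  - exists x. apply Hp. now left.
  - assert (y = x) as -> by (apply Hp in Hy; tauto).
    apply Hdisj. now exists x.
Qed.

Lemma binary_union (M : set_structure) (HM : ZF M) (A B : M) :
  exists u : M, forall z : M, z ∈ u <-> z ∈ A \/ z ∈ B.
Proof.
  destruct (ZF_pairing HM A B) as [p Hp].
  destruct (ZF_union HM p) as [u Hu].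
  exists u. intros z. rewrite (Hu z). split.
  - intros [y [Hy Hz]]. apply Hp in Hy. destruct Hy; subst; tauto.
  - intros [H | H]; [exists A | exists B]; rewrite (Hp _); tauto.
Qed.

Lemma adjoin (M : set_structure) (HM : ZF M) (A : M) :
  exists s : M, is_succ s A.
Proof.
  destruct (ZF_pairing HM A A) as [p Hp].
  destruct (binary_union HM A p) as [u Hu].
  exists u. intros z. rewrite (Hu z), (Hp z). tauto.
Qed.

(** * Ordered pairs and relations *)

Lemma is_pair_unique (M : set_structure) (HM : ZF M) (p q a b : M) :
  is_pair p a b -> is_pair q a b -> p = q.
Proof.
  intros Hp Hq. apply (ZF_extensionality HM). intros z.
  now rewrite (Hp z), (Hq z).
Qed.

Lemma is_pair_exists (M : set_structure) (HM : ZF M) (a b : M) :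
  exists p : M, is_pair p a b.
Proof.
  destruct (ZF_pairing HM a a) as [s Hs].
  destruct (ZF_pairing HM a b) as [t Ht].
  destruct (ZF_pairing HM s t) as [p Hp].
  exists p. intros x. rewrite (Hp x). split.
  - intros [-> | ->]; tauto.
  - intros [H | H]; [left | right]; apply (ZF_extensionality HM); intros z.
    + now rewrite (H z), (Hs z).
    + now rewrite (H z), (Ht z).
Qed.

Lemma is_pair_fst (M : set_structure) (HM : ZF M) (p a b a' b' : M) :
  is_pair p a b -> is_pair p a' b' -> a = a'.
Proof.
  intros H H'.
  (* The singleton of [a] is a member of the pair, and both members of the pair
     contain [a']. *)
  destruct (ZF_pairing HM a a) as [s Hs].
  assert (Hsp : s ∈ p) by (apply H; now left).
  assert (Ha' : a' ∈ s).
  { apply H' in Hsp. destruct Hsp as [K | K]; apply K; now left. }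
  apply Hs in Ha'. destruct Ha'; congruence.
Qed.

Lemma is_pair_snd_cases (M : set_structure) (HM : ZF M) (p a b b' : M) :
  is_pair p a b -> is_pair p a b' -> b = a \/ b = b'.
Proof.
  intros H H'.
  destruct (ZF_pairing HM a b) as [t Ht].
  assert (Htp : t ∈ p) by (apply H; now right).
  assert (Hb : b ∈ t) by (apply Ht; now right).
  apply H' in Htp. destruct Htp as [K | K]; apply K in Hb; tauto.
Qed.

Lemma is_pair_injective (M : set_structure) (HM : ZF M) (p a b a' b' : M) :
  is_pair p a b -> is_pair p a' b' -> a = a' /\ b = b'.
Proof.
  intros H H'.
  assert (a' = a) as -> by exact (is_pair_fst HM H' H).
  split; [reflexivity |].
  destruct (is_pair_snd_cases HM H H') as [E | E]; [| exact E].
  destruct (is_pair_snd_cases HM H' H) as [E' | E']; congruence.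
Qed.

(** A Kuratowski pair of an element of [A] and an element of [B] is a set of
    subsets of the union of [A] and [B], so the product is separated from the
    double power set of this union. *)
Lemma product_exists (M : set_structure) (HM : ZF M) (A B : M) :
  exists c : M, forall p : M,
    p ∈ c <-> exists a b : M, a ∈ A /\ b ∈ B /\ is_pair p a b.
Proof.
  destruct (binary_union HM A B) as [u Hu].
  destruct (ZF_powerset HM u) as [pu Hpu].
  destruct (ZF_powerset HM pu) as [ppu Hppu].
  destruct (ZF_separation HM
    (fEx (fEx (fAnd (fMem 1 3) (fAnd (fMem 0 4) (fPair 2 1 0)))))
    (scons A (fun _ => B)) ppu) as [c Hc].
  exists c. intros p. split.
  - intros Hp. apply Hc in Hp. exact (proj2 Hp).
  - intros Hex. apply Hc. split; [| exact Hex].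
    destruct Hex as [a [b [Ha [Hb Hp]]]].
    apply Hppu. intros x Hx. apply Hpu. intros z Hz. apply Hu.
    apply Hp in Hx.
    destruct Hx as [K | K]; apply K in Hz; destruct Hz as [-> | ->]; tauto.
Qed.

(** Comprehension for relations from [A] to [B].  The formula [phi] is read in
    an environment that lists the second coordinate, the first coordinate, the
    pair itself and then the parameters; having the pair there spares any
    renumbering of the variables of [phi]. *)
Lemma relation_comprehension (M : set_structure) (HM : ZF M) (A B : M)
    (R : M -> M -> Prop) (phi : formula) (e : nat -> M) :
  (forall p a b : M, sat (scons b (scons a (scons p e))) phi <-> R a b) ->
  exists r : M, is_relation r A B /\
    forall a b : M, related r a b <-> a ∈ A /\ b ∈ B /\ R a b.
Proof.
  intros Hphi.
  destruct (product_exists HM A B) as [c Hc].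
  destruct (ZF_separation HM (fEx (fEx (fAnd (fPair 2 1 0) phi))) e c)
    as [r Hr].
  exists r. split; [| intros a b; split].
  - intros p Hp. apply Hr in Hp. apply Hc. tauto.
  - intros [p [Hp Hpr]]. apply Hr in Hpr.
    destruct Hpr as [Hpc [a1 [b1 [Hp1 HR]]]].
    apply Hc in Hpc. destruct Hpc as [a2 [b2 [Ha [Hb Hp2]]]].
    apply Hphi in HR.
    destruct (is_pair_injective HM Hp Hp1); subst.
    destruct (is_pair_injective HM Hp Hp2); subst.
    tauto.
  - intros [Ha [Hb HR]].
    destruct (is_pair_exists HM a b) as [p Hp].
    exists p. split; [exact Hp |].
    apply Hr. split.
    + apply Hc. now exists a, b.
    + exists a, b. split; [exact Hp | now apply Hphi].
Qed.

Lemma subset_of_related (M : set_structure) (HM : ZF M) (r r' A B : M) :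
  is_relation r A B ->
  (forall a b : M, related r a b -> related r' a b) ->
  subset r r'.
Proof.
  intros Hr Hrel p Hp.
  destruct (Hr p Hp) as [a [b [_ [_ Hab]]]].
  destruct (Hrel a b) as [q [Hq Hqr]].
  - now exists p.
  - now rewrite (is_pair_unique HM Hab Hq).
Qed.

Lemma related_subset (M : set_structure) (r r' a b : M) :
  subset r r' -> related r a b -> related r' a b.
Proof.
  intros Hsub [p [Hp Hpr]]. exists p. auto.
Qed.

(** * From choice to solution functions *)

Lemma solution_of_choice (M : set_structure) (HM : ZF M)
    (P : kolmogorov_problem M) :
  axiom_of_choice M -> viable P -> exists f : M, solution_function P f.
Proof.
  intros AC Hviable.
  set (I := instances P) in *. set (T := solutions P) in *.
  set (sigma := solves P) in *.
  destruct (ZF_powerset HM T) as [pT HpT].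
  destruct (ZF_separation HM (fEx (fMem 0 1)) (fun _ => T) pT) as [F HF].
  assert (HFne : forall X : M, X ∈ F -> nonempty X).
  { intros X HX. apply HF in HX. exact (proj2 HX). }
  destruct (AC F HFne) as [c [[U [_ [_ Hc]]] Hin]].
  set (fiber := fun z X : M => forall t : M,
    t ∈ X <-> t ∈ T /\ related sigma z t).
  assert (fiber_unique : forall z X Y : M, fiber z X -> fiber z Y -> X = Y).
  { intros z X Y HX HY. apply (ZF_extensionality HM). intros t.
    now rewrite (HX t), (HY t). }
  assert (fiber_in_F : forall z : M, z ∈ I -> exists X, fiber z X /\ X ∈ F).
  { intros z Hz.
    destruct (ZF_separation HM (fRelated 1 2 0) (scons sigma (fun _ => z)) T)
      as [X HX].
    change (fiber z X) in HX.
    exists X. split; [exact HX |].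
    apply HF. split.
    - apply HpT. intros t Ht. apply HX in Ht. tauto.
    - destruct (Hviable z Hz) as [s Hs]. exists s. now apply HX. }
  (* Parameters: 3 is [T], 4 is [sigma], 5 is [c]; the quantifiers shift them. *)
  destruct (relation_comprehension HM I T
    (R := fun z s => exists X : M, fiber z X /\ related c X s)
    (phi := fEx (fAnd
       (fAll (fIff (fMem 0 1) (fAnd (fMem 0 5) (fRelated 6 3 0))))
       (fRelated 6 0 1)))
    (e := scons T (scons sigma (fun _ => c)))) as [f [Hfrel Hf]].
  { reflexivity. }
  exists f. split; [split; [exact Hfrel |] |].
  - intros z Hz.
    destruct (fiber_in_F z Hz) as [X [HX HXF]].
    destruct (Hc X HXF) as [s [Hs Huniq]].
    exists s. split.
    + apply Hf. split; [exact Hz |]. split; [| now exists X].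
      apply Hin in Hs. apply HX in Hs. tauto.
    + intros s' Hs'. apply Hf in Hs'. destruct Hs' as [_ [_ [Y [HY Hs']]]].
      rewrite (fiber_unique z Y X HY HX) in Hs'. now apply Huniq.
  - apply (subset_of_related HM Hfrel). intros z s Hs.
    apply Hf in Hs. destruct Hs as [_ [_ [X [HX Hs]]]].
    apply Hin in Hs. apply HX in Hs. tauto.
Qed.

(** * From solution functions to choice *)

Lemma choice_of_empty (M : set_structure) (HM : ZF M) (F : M) :
  ~ nonempty F -> exists f : M, choice_function F f.
Proof.
  intros HF.
  destruct (ZF_union HM F) as [U HU].
  (* The empty family is itself the empty function. *)
  exists F. split.
  - exists U. split; [exact HU |]. split.
    + intros p Hp. destruct HF. now exists p.
    + intros X HX. destruct HF. now exists X.
  - intros X x [p [_ Hp]]. destruct HF. now exists p.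
Qed.

(** The second disjunct is what destroys genericity: no element of [U] can
    solve the adjoined instance [F], even if it lies in all members of [F]. *)
Lemma choice_problem_exists (M : set_structure) (HM : ZF M) (F U I T : M) :
  is_succ I F -> is_succ T U -> is_union U F ->
  exists P : kolmogorov_problem M,
    instances P = I /\ solutions P = T /\
    forall X x : M, related (solves P) X x <->
      (X ∈ F /\ x ∈ X) \/ (X = F /\ x = U).
Proof.
  intros HI HT HU.
  destruct (relation_comprehension HM I T
    (R := fun X x => (X ∈ F /\ x ∈ X) \/ (X = F /\ x = U))
    (phi := fOr (fAnd (fMem 1 3) (fMem 0 1)) (fAnd (fEq 1 3) (fEq 0 4)))
    (e := scons F (fun _ => U))) as [sigma [Hrel Hsigma]].
  { reflexivity. }
  exists (KolmogorovProblem Hrel). split; [reflexivity |].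
  split; [reflexivity |].
  intros X x. simpl. rewrite (Hsigma X x), (HI X), (HT x).
  split; [tauto |].
  intros [[HX Hx] | [HX Hx]]; [| tauto].
  assert (x ∈ U) by (apply HU; now exists X). tauto.
Qed.

Lemma choice_of_solutions (M : set_structure) (HM : ZF M) :
  (forall P : kolmogorov_problem M, veloso_problem P ->
     exists f : M, solution_function P f) ->
  axiom_of_choice M.
Proof.
  intros Hsol F HFne.
  destruct (classic (nonempty F)) as [HF | HF];
    [| now apply choice_of_empty].
  destruct (ZF_union HM F) as [U HU].
  destruct (adjoin HM F) as [I HI].
  destruct (adjoin HM U) as [T HT].
  pose proof (mem_irreflexive HM (x := F)) as HFF.
  pose proof (mem_irreflexive HM (x := U)) as HUU.
  assert (HinU : forall X x : M, X ∈ F -> x ∈ X -> x ∈ U).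
  { intros X x HX Hx. apply HU. now exists X. }
  destruct (choice_problem_exists HM HI HT HU) as [P [EI [ET Hsigma]]].
  destruct (Hsol P) as [f [[_ Hf] Hsub]].
  { unfold veloso_problem, viable, non_generic. rewrite EI, ET.
    split; [| split; [| split]].
    - exists F. apply HI. now right.
    - exists U. apply HT. now right.
    - intros X HX. apply HI in HX. destruct HX as [HX | ->].
      + destruct (HFne X HX) as [x Hx]. exists x. split.
        * apply HT. left. exact (HinU X x HX Hx).
        * apply Hsigma. tauto.
      + exists U. split; [apply HT; tauto | apply Hsigma; tauto].
    - intros s Hs. apply HT in Hs. destruct Hs as [Hs | ->].
      + exists F. split; [apply HI; tauto |].
        intros Hrel. apply Hsigma in Hrel.
        destruct Hrel as [[K _] | [_ ->]]; tauto.
      + destruct HF as [X HX]. exists X. split; [apply HI; tauto |].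
        intros Hrel. apply Hsigma in Hrel.
        destruct Hrel as [[_ K] | [-> _]]; [| tauto].
        exact (HUU (HinU X U HX K)). }
  assert (Hval : forall X x : M, X ∈ F -> related f X x -> x ∈ X).
  { intros X x HX Hx. apply (related_subset Hsub) in Hx.
    apply Hsigma in Hx. destruct Hx as [[_ Hx] | [-> _]]; tauto. }
  destruct (relation_comprehension HM F U (R := related f)
    (phi := fRelated 3 1 0) (e := fun _ => f)) as [g [Hgrel Hg]].
  { reflexivity. }
  exists g. split.
  - exists U. split; [exact HU |]. split; [exact Hgrel |].
    intros X HX.
    destruct (Hf X) as [x [Hx Huniq]].
    { rewrite EI. apply HI. now left. }
    exists x. split.
    + apply Hg. split; [exact HX |]. split; [| exact Hx].
      exact (HinU X x HX (Hval X x HX Hx)).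
    + intros y Hy. apply Hg in Hy. now apply Huniq.
  - intros X x Hx. apply Hg in Hx. destruct Hx as [HX [_ Hx]].
    exact (Hval X x HX Hx).
Qed.

Theorem theorem3p12 (M : set_structure) (HM : ZF M) :
  axiom_of_choice M <->
  (forall P : kolmogorov_problem M, veloso_problem P ->
     exists f : M, solution_function P f).
Proof.
  split.
  - intros AC P [_ [_ [Hviable _]]]. exact (solution_of_choice HM AC Hviable).
  - exact (choice_of_solutions HM).
Qed.
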